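(* Let $A$ be a linearly ordered $Q$-Smarandache pseudo-BCK algebra. If $v:A\to A$ is a very true operator on the pseudo-BCK algebra $A$, then the restriction $v_{\mid Q}:Q\to Q$ is a very true operator on the pseudo-MTL algebra $Q$ (i.e. $v$ is a very true $Q$-Smarandache operator on $A$).
   Context: A pseudo-BCK algebra is a structure $(A,\leq,\rightarrow,\rightsquigarrow,1)$ where $\leq$ is a binary relation on $A$, $\rightarrow$ and $\rightsquigarrow$ are binary operations on $A$ and $1\in A$, such that for all $x,y,z\in A$: $x\rightarrow y\leq (y\rightarrow z)\rightsquigarrow (x\rightarrow z)$ and $x\rightsquigarrow y\leq (y\rightsquigarrow z)\rightarrow (x\rightsquigarrow z)$; $x\leq (x\rightarrow y)\rightsquigarrow y$ and $x\leq (x\rightsquigarrow y)\rightarrow y$; $x\leq x$; $x\leq 1$; if $x\leq y$ and $y\leq x$ then $x=y$; $x\leq y$ iff $x\rightarrow y=1$ iff $x\rightsquigarrow y=1$. It is bounded if there is an element $0\in A$ with $0\leq x$ for all $x\in A$, and linearly ordered if $\leq$ is total. A very true operator on a pseudo-BCK algebra $A$ is a map $v:A\to A$ such that for all $x,y\in A$: (VT1) $v(1)=1$; (VT2) $v(x)\leq x$; (VT3) $v(x)\leq v(v(x))$; (VT4) $v(x\rightarrow y)\leq v(x)\rightarrow v(y)$ and $v(x\rightsquigarrow y)\leq v(x)\rightsquigarrow v(y)$. An FL$_w$-algebra is an algebra $(Q,\wedge,\vee,\odot,\rightarrow,\rightsquigarrow,0,1)$ such that $(Q,\wedge,\vee)$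 is a lattice with least element $0$ and greatest element $1$, $(Q,\odot,1)$ is a monoid, and $x\odot y\leq z$ iff $x\leq y\rightarrow z$ iff $y\leq x\rightsquigarrow z$ for all $x,y,z\in Q$. It is a pseudo-MTL algebra if $(x\rightarrow y)\vee(y\rightarrow x)=(x\rightsquigarrow y)\vee(y\rightsquigarrow x)=1$ for all $x,y\in Q$. A very true operator on an FL$_w$-algebra (in particular on a pseudo-MTL algebra) is a self-map $v$ satisfying (VT1)–(VT4) and (VT5) $v(x\vee y)\leq v(x)\vee v(y)$ for all $x,y$. A bounded pseudo-BCK algebra $(A,\rightarrow,\rightsquigarrow,0,1)$ is a $Q$-Smarandache pseudo-BCK algebra if $Q$ is a proper subset of $A$ such that $0,1\in Q$, $|Q|\geq 3$, and $(Q,\wedge,\vee,\odot,\rightarrow,\rightsquigarrow,0,1)$ is a pseudo-MTL algebra, where $\rightarrow,\rightsquigarrow$ on $Q$ are the operations of $A$. A map $v:A\to A$ is a very true $Q$-Smarandache operator if $v_{\mid Q}:Q\to Q$ is a very true operator on the pseudo-MTL algebra $Q$.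
   Formalization: The theorem additionally assumes that v maps Q into Q, so that the restriction v|Q: Q→Q exists; this does not follow in general (Gödel chain 0<a<b<1, Q={0,b,1}, v fixing 0,a,1 and v(b)=a). *)

(* Defs.v *)
From mathcomp Require Import all_boot.
From mathcomp Require Import boolp classical_sets functions cardinality.
Set Implicit Arguments.
Unset Strict Implicit.
Unset Printing Implicit Defensive.
Local Open Scope classical_set_scope.
Local Open Scope card_scope.

Record pseudoBCK (A : Type) := PseudoBCK {
  bck_le : A -> A -> Prop;
  bck_imp : A -> A -> A;
  bck_rimp : A -> A -> A;
  bck_one : A;
  bck_imp_trans : forall x y z,
    bck_le (bck_imp x y) (bck_rimp (bck_imp y z) (bck_imp x z));
  bck_rimp_trans : forall x y z,
    bck_le (bck_rimp x y) (bck_imp (bck_rimp y z) (bck_rimp x z));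
  bck_le_imp_rimp : forall x y, bck_le x (bck_rimp (bck_imp x y) y);
  bck_le_rimp_imp : forall x y, bck_le x (bck_imp (bck_rimp x y) y);
  bck_le_refl : forall x, bck_le x x;
  bck_le_one : forall x, bck_le x bck_one;
  bck_le_antisym : forall x y, bck_le x y -> bck_le y x -> x = y;
  bck_le_imp : forall x y, bck_le x y <-> bck_imp x y = bck_one;
  bck_le_rimp : forall x y, bck_le x y <-> bck_rimp x y = bck_one
}.

Record boundedPseudoBCK (A : Type) := BoundedPseudoBCK {
  bounded_bck :> pseudoBCK A;
  bck_zero : A;
  bck_zero_le : forall x, bck_le bounded_bck bck_zero x
}.

Definition linearly_ordered (A : Type) (B : pseudoBCK A) : Prop :=
  forall x y, bck_le B x y \/ bck_le B y x.

(* The lattice is given by its operations, as in the signature of an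
   FL_w-algebra; no [choiceType] or decidable order is required of [T]. *)
Record FLw (T : Type) := FLwAlgebra {
  fl_meet : T -> T -> T;
  fl_join : T -> T -> T;
  fl_mul : T -> T -> T;
  fl_imp : T -> T -> T;
  fl_rimp : T -> T -> T;
  fl_zero : T;
  fl_one : T;
  fl_le := fun x y => fl_meet x y = x;
  fl_meetC : forall x y, fl_meet x y = fl_meet y x;
  fl_joinC : forall x y, fl_join x y = fl_join y x;
  fl_meetA : forall x y z, fl_meet x (fl_meet y z) = fl_meet (fl_meet x y) z;
  fl_joinA : forall x y z, fl_join x (fl_join y z) = fl_join (fl_join x y) z;
  fl_meetUK : forall x y, fl_meet x (fl_join x y) = x;
  fl_joinIK : forall x y, fl_join x (fl_meet x y) = x;
  fl_zero_le : forall x, fl_le fl_zero x;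
  fl_le_one : forall x, fl_le x fl_one;
  fl_mulA : forall x y z, fl_mul x (fl_mul y z) = fl_mul (fl_mul x y) z;
  fl_mul1x : forall x, fl_mul fl_one x = x;
  fl_mulx1 : forall x, fl_mul x fl_one = x;
  fl_mul_imp : forall x y z, fl_le (fl_mul x y) z <-> fl_le x (fl_imp y z);
  fl_mul_rimp : forall x y z, fl_le (fl_mul x y) z <-> fl_le y (fl_rimp x z)
}.

Record pseudoMTL (T : Type) := PseudoMTL {
  mtl_flw :> FLw T;
  prelinear : forall x y,
    fl_join mtl_flw (fl_imp mtl_flw x y) (fl_imp mtl_flw y x) = fl_one mtl_flw;
  rprelinear : forall x y,
    fl_join mtl_flw (fl_rimp mtl_flw x y) (fl_rimp mtl_flw y x) = fl_one mtl_flw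
}.

(* The axioms common to pseudo-BCK algebras and FL_w-algebras; the condition
   on joins is added in [very_true_FLw]. *)
Record VT14 (T : Type) (leT : T -> T -> Prop) (impT rimpT : T -> T -> T)
    (oneT : T) (v : T -> T) : Prop := MkVT14 {
  VT1 : v oneT = oneT;
  VT2 : forall x, leT (v x) x;
  VT3 : forall x, leT (v x) (v (v x));
  VT4 : forall x y, leT (v (impT x y)) (impT (v x) (v y));
  VT4r : forall x y, leT (v (rimpT x y)) (rimpT (v x) (v y))
}.

Definition very_true_BCK (A : Type) (B : pseudoBCK A) (v : A -> A) : Prop :=
  VT14 (bck_le B) (bck_imp B) (bck_rimp B) (bck_one B) v.

Definition very_true_FLw (T : Type) (F : FLw T) (v : T -> T) : Prop :=
  VT14 (fl_le F) (fl_imp F) (fl_rimp F) (fl_one F) v /\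
  forall x y, fl_le F (v (fl_join F x y)) (fl_join F (v x) (v y)).

(* The operations of the algebra on [Q] are operations on the subtype [Q];
   the compatibility equations therefore also say that [Q] is closed under
   both implications of [A]. *)
Record smarandache (A : Type) (B : boundedPseudoBCK A) (Q : set A) :=
  Smarandache {
  sm_proper : Q `<` [set: A];
  sm_zero : Q (bck_zero B);
  sm_one : Q (bck_one B);
  sm_card : `I_3 #<= Q;
  sm_mtl : pseudoMTL Q;
  sm_impE : forall x y : Q,
    val (fl_imp sm_mtl x y) = bck_imp B (val x) (val y);
  sm_rimpE : forall x y : Q,
    val (fl_rimp sm_mtl x y) = bck_rimp B (val x) (val y);
  sm_zeroE : val (fl_zero sm_mtl) = bck_zero B;
  sm_oneE : val (fl_one sm_mtl) = bck_one B
}.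

(* The type [Q -> Q] of the restriction makes sense only if [v] maps [Q] into
   [Q]; see [very_true_smarandache]. *)
Definition restriction (A : Type) (Q : set A) (v : A -> A)
    (vQ : set_fun Q Q v) : Q -> Q :=
  fun x => exist _ (v (val x)) (mem_set (vQ _ (set_mem (valP x)))).

Definition very_true_smarandache (A : Type) (B : boundedPseudoBCK A)
    (Q : set A) (S : smarandache B Q) (v : A -> A) : Prop :=
  exists vQ : set_fun Q Q v, very_true_FLw (sm_mtl S) (restriction vQ).

(* Main.v *)
Require Import Defs.
From mathcomp Require Import all_boot.
From mathcomp Require Import boolp classical_sets functions cardinality.

(** In an FL_w-algebra, residuation and integrality give [x <= y] iff
    [x -> y = 1], which is also how the order of a pseudo-BCK algebra is tied to
    its implication.  As the implications and the unit of [Q] are those of [A],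
    the lattice order of [Q] is therefore the order induced by [A]
    ([smarandache_leE]).  It follows that (VT1)--(VT4) pass from [A] to [Q],
    and that [Q] is a chain when [A] is.  On a chain every map satisfies (VT5),
    because [x \/ y] is one of [x] and [y] ([fl_map_join_chain]). *)

Section FLwOrder.
Context {T : Type} (F : FLw T).

Lemma fl_joinxx x : fl_join F x x = x.
Proof. by rewrite -{2}(fl_meetUK F x x) fl_joinIK. Qed.

Lemma fl_le_refl x : fl_le F x x.
Proof. by rewrite /fl_le -{2}(fl_joinxx x) fl_meetUK. Qed.

Lemma fl_le_joinl x y : fl_le F x (fl_join F x y).
Proof. exact: fl_meetUK. Qed.

Lemma fl_le_joinr x y : fl_le F y (fl_join F x y).
Proof. by rewrite fl_joinC; exact: fl_le_joinl. Qed.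

Lemma fl_le_join_eq x y : fl_le F x y -> fl_join F x y = y.
Proof. by move=> <-; rewrite fl_joinC fl_meetC fl_joinIK. Qed.

Lemma fl_one_le x : fl_le F (fl_one F) x <-> x = fl_one F.
Proof.
split=> [h | ->]; last exact: fl_le_refl.
by rewrite -h fl_meetC; symmetry; exact: fl_le_one.
Qed.

(** Residuate [1 * x <= y]; above [1] there is only [1]. *)
Lemma fl_le_imp x y : fl_le F x y <-> fl_imp F x y = fl_one F.
Proof. by rewrite -fl_one_le -fl_mul_imp fl_mul1x. Qed.

(** In a chain [x \/ y] is [x] or [y], so the left-hand side is already [v x]
    or [v y]. *)
Lemma fl_map_join_chain (v : T -> T) :
  (forall x y, fl_le F x y \/ fl_le F y x) ->
  forall x y, fl_le F (v (fl_join F x y)) (fl_join F (v x) (v y)).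
Proof.
move=> total x y; have [le_xy | le_yx] := total x y.
- by rewrite (fl_le_join_eq _ _ le_xy); exact: fl_le_joinr.
- by rewrite (fl_joinC F x) (fl_le_join_eq _ _ le_yx); exact: fl_le_joinl.
Qed.

End FLwOrder.

(** Both orders are determined by the implication and the unit, which [Q]
    inherits from [A]. *)
Lemma smarandache_leE (A : Type) (B : boundedPseudoBCK A) (Q : set A)
    (S : smarandache B Q) (x y : Q) :
  fl_le (sm_mtl S) x y <-> bck_le B (val x) (val y).
Proof.
rewrite fl_le_imp bck_le_imp -(sm_impE S) -(sm_oneE S).
by split=> [-> // | /val_inj].
Qed.

Theorem proposition6p11 (A : Type) (B : boundedPseudoBCK A) (Q : set A)
    (S : smarandache B Q) (v : A -> A) :
  linearly_ordered B ->
  (* the restriction of [v] to [Q] is a map from [Q] to [Q] *)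
  set_fun Q Q v ->
  very_true_BCK B v ->
  very_true_smarandache S v.
Proof.
move=> total vQ [v1 v_le v_idem v_imp v_rimp]; exists vQ; split.
- split=> [|x|x|x y|x y].
  + by apply: val_inj; rewrite /= (sm_oneE S).
  + by apply/smarandache_leE; exact: v_le.
  + by apply/smarandache_leE; exact: v_idem.
  + by apply/smarandache_leE; rewrite (sm_impE S) /= (sm_impE S); exact: v_imp.
  + by apply/smarandache_leE; rewrite (sm_rimpE S) /= (sm_rimpE S);
       exact: v_rimp.
- by apply: fl_map_join_chain => x y; rewrite !smarandache_leE; exact: total.
Qed.
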